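(* Every tree $T$ can be realized in $\mathbb{R}^2$; that is, if $T=(U,\mathcal{C})$ is a median set system whose 1-inclusion graph is a tree, then $\dim_{\mathbb{E}}(T)\leq 2$.
   Context: $U$ is a finite set and $\mathcal{C}\subseteq 2^U$. The 1-inclusion graph of $\mathcal{C}$ has vertex set $\mathcal{C}$, two sets being adjacent when their symmetric difference has exactly one element. A median set system is a pair $(U,\mathcal{C})$ satisfying (C1$'$) $\varnothing\in\mathcal{C}$; (C2) $X\cap Y\in\mathcal{C}$ for all $X,Y\in\mathcal{C}$; (C6) for any $x\neq y$ in $U$ there is $K\in\mathcal{C}$ with $|\{x,y\}\cap K|=1$; (C7) if $K_i,M_i\in\mathcal{C}$ ($i=1,2,3$) satisfy $K_i\cup K_j\subseteq M_k$ whenever $\{i,j,k\}=\{1,2,3\}$, then $K_1\cup K_2\cup K_3\in\mathcal{C}$. A set family is called a tree if it is a median set system whose 1-inclusion graph is a tree (a connected acyclic graph). A realization of $\mathcal{C}\subseteq 2^U$ in $\mathbb{R}^m$ consists of oriented affine hyperplanes $(H_e)_{e\in U}$ of $\mathbb{R}^m$, where $H_e=\{x:a_e\cdot x=b_e\}$ with $a_e\neq 0$, $H_e^+=\{x:a_e\cdot x>b_e\}$, $H_e^-=\{x:a_e\cdot x<b_e\}$, and a relatively open convex set $K\subseteq\mathbb{R}^m$ such that $X\subseteq U$ belongs to $\mathcal{C}$ if and only if there is $x\in K$ with $x\in H_e^+$ for all $e\in X$ and $x\in H_e^-$ for all $e\in U\setminus X$. The Euclidean dimension $\dim_{\mathbb{E}}$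 is the smallest $m$ such that a realization in $\mathbb{R}^m$ exists. *)

(* Defs.v *)
From mathcomp Require Import all_boot all_order all_algebra.
From mathcomp Require Import all_classical reals topology normedtype convex.

Set Implicit Arguments.
Unset Strict Implicit.
Unset Printing Implicit Defensive.

Import Order.TTheory GRing.Theory Num.Theory.
Import numFieldNormedType.Exports.

Local Open Scope ring_scope.

Definition is_tree (V : finType) (e : rel V) : Prop :=
  [/\ (0 < #|V|)%N, (* connected graphs are nonempty *)
      symmetric e, irreflexive e,
      forall x y : V, connect e x y &
      (* the size bound excludes x -- y -- x, a cycle in the sense of ucycle *)
      forall s : seq V, (2 < size s)%N -> ~ ucycle e s].

Section SetFamilies.

Variables (U : finType) (C : {set {set U}}).

Definition symdiff (X Y : {set U}) : {set U} := (X :\: Y) :|: (Y :\: X).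

Definition one_inclusion : rel {X : {set U} | X \in C} :=
  [rel X Y | #|symdiff (val X) (val Y)| == 1%N].

(* [finset.set0] is the empty finite set: [set0] is the one of classical_sets. *)
Definition median_set_system : Prop :=
  [/\ finset.set0 \in C,
      forall X Y : {set U}, X \in C -> Y \in C -> X :&: Y \in C,
      forall x y : U, x != y ->
        exists2 K : {set U}, K \in C & #|[set x; y] :&: K| = 1%N &
      forall K1 K2 K3 M1 M2 M3 : {set U},
        [/\ K1 \in C, K2 \in C & K3 \in C] ->
        [/\ M1 \in C, M2 \in C & M3 \in C] ->
        [/\ K2 :|: K3 \subset M1, K1 :|: K3 \subset M2
          & K1 :|: K2 \subset M3] ->
        K1 :|: K2 :|: K3 \in C].

Definition tree_set_system : Prop :=
  median_set_system /\ is_tree one_inclusion.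

End SetFamilies.

Section Realizations.

Variable R : realType.

Definition dot m (a x : 'rV[R]_m) : R := \sum_(i < m) a 0 i * x 0 i.

Definition pos_side m (a : 'rV[R]_m) (b : R) : set 'rV[R]_m :=
  [set x | dot a x > b]%classic.

Definition neg_side m (a : 'rV[R]_m) (b : R) : set 'rV[R]_m :=
  [set x | dot a x < b]%classic.

Definition affine_hull m (K : set 'rV[R]_m) : set 'rV[R]_m :=
  [set x | exists n (w : 'I_n -> R) (p : 'I_n -> 'rV[R]_m),
     [/\ forall i, K (p i), \sum_(i < n) w i = 1
       & x = \sum_(i < n) w i *: p i]]%classic.

Definition relatively_open m (K : set 'rV[R]_m) : Prop :=
  open (K : set (subspace (affine_hull K))).

Definition is_realization (U : finType) (C : {set {set U}}) m
    (a : U -> 'rV[R]_m) (b : U -> R) (K : set 'rV[R]_m) : Prop :=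
  [/\ forall e, a e != 0, relatively_open K, convex_set K &
      forall X : {set U}, X \in C <->
        exists x, [/\ K x,
          forall e, e \in X -> pos_side (a e) (b e) x &
          forall e, e \notin X -> neg_side (a e) (b e) x]].

Definition realizable (U : finType) (C : {set {set U}}) (m : nat) : Prop :=
  exists (a : U -> 'rV[R]_m) (b : U -> R) (K : set 'rV[R]_m),
    is_realization C a b K.

(* A relation, since a family need not be realizable in any dimension. *)
Definition euclidean_dim (U : finType) (C : {set {set U}}) (d : nat) : Prop :=
  realizable C d /\ forall m, realizable C m -> (d <= m)%N.

End Realizations.

(* Main.v *)
Require Import Defs.
From mathcomp Require Import all_boot all_order all_algebra.
From mathcomp Require Import all_classical interval_inference reals topology normedtype convex.
From mathcomp Require Import ring lra.

Set Implicit Arguments.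
Unset Strict Implicit.
Unset Printing Implicit Defensive.

Import Order.TTheory GRing.Theory Num.Theory.
Import numFieldNormedType.Exports.

(* In a tree, the members below a fixed member form a chain: two incomparable
   ones A, B would, by (C7), span a 4-cycle on A :&: B.  So C, ordered by
   inclusion, is a rooted forest whose nodes are the least members containing
   the elements e.  Such a forest is represented by a laminar family of
   intervals ]l_e, r_e[, and e is sent to the line cutting the parabola y = x^2
   at the abscissas l_e and r_e.  These chords do not cross inside the convex
   region y > x^2, and the caps they cut off are nested or disjoint exactly as
   the intervals are. *)

(** * Members below a common member form a chain *)

(** This is (C7) with the empty set as third set and [M] as all three bounds. *)
Lemma bounded_setU (U : finType) (C : {set {set U}}) (A B M : {set U}) :
  median_set_system C -> A \in C -> B \in C -> M \in C ->
  A \subset M -> B \subset M -> A :|: B \in C.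
Proof.
case=> C0 _ _ C7 AC BC MC sAM sBM.
rewrite -[A :|: B]finset.setU0; apply: (C7 A B _ M M M) => //.
by rewrite !finset.subUset sAM sBM finset.sub0set.
Qed.

(* The connecting walk X_0, ..., X_n from A to B is pushed into the interval
   between A and B by X |-> A :|: X :&: B; the first set it then leaves A for
   is A plus one element. *)
Lemma up_step (U : finType) (C : {set {set U}}) (A B : {set U}) :
  tree_set_system C -> A \in C -> B \in C -> A \proper B ->
  exists a, [/\ a \in B, a \notin A & a |: A \in C].
Proof.
move=> [med [_ _ _ conn _]] AC BC /fintype.properP[sAB [b bB bNA]].
have /connectP[p] := conn (exist _ A AC) (exist _ B BC).
(* The induction along the walk keeps this invariant: the current set meets [B] only inside [A]. *)
have : val (exist (fun X => X \in C) A AC) :&: B \subset A.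
  exact: finset.subsetIl.
elim: p (exist _ A AC) => [|y p IHp] x /= sxA.
  by move=> _ xB; move: sxA; rewrite -xB /= finset.setIid => /fintype.subsetP/(_ b bB);
     rewrite (negPf bNA).
case/andP=> /finset.cards1P[a xya] yp yB.
have [syA|] := boolP (val y :&: B \subset A); first exact: (IHp y).
case/fintype.subsetPn=> c; rewrite finset.inE => /andP[cy cB] cNA.
have cNx : c \notin val x.
  by apply: contra cNA => cx; apply: (fintype.subsetP sxA); rewrite finset.inE cx.
have ac : c = a.
  by apply/finset.set1P; rewrite -xya !finset.inE cy cNx orbT.
exists c; split=> //.
(* Since [x] and [y] differ in [c] alone, [c] is the only element of [val y :&: B] outside [A]. *)
have -> : c |: A = A :|: (val y :&: B).
  apply/finset.setP => z; rewrite !finset.inE.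
  have [-> | zc] := eqVneq z c; first by rewrite cy cB orbT.
  have [//|zNA] /= := boolP (z \in A).
  apply/esym/negbTE/negP => /andP[zy zB].
  have zNx : z \notin val x.
    by apply: contra zNA => zx; apply: (fintype.subsetP sxA); rewrite finset.inE zx.
  have /finset.set1P za : z \in [set a]%SET by rewrite -xya !finset.inE zy zNx orbT.
  by rewrite za -ac eqxx in zc.
apply: (bounded_setU med AC _ BC sAB (finset.subsetIr _ _)).
by case: med => _ C2 _ _; apply: C2 => //; apply: valP.
Qed.

Lemma symdiffC (U : finType) (X Y : {set U}) : symdiff X Y = symdiff Y X.
Proof. exact: finset.setUC. Qed.

Lemma card_symdiff_setU1 (U : finType) (c : U) (X : {set U}) :
  c \notin X -> #|symdiff X (c |: X)| == 1.
Proof.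
move=> cNX; apply/finset.cards1P; exists c; apply/finset.setP => z.
by rewrite !finset.inE; have [->|zc] /= := eqVneq z c; [rewrite cNX | case: (z \in X)].
Qed.

(** If neither contained the other, [up_step] from [D = A :&: B] towards each of them would give
    members [a |: D] and [b |: D]. Both lie below [M], so their union would be a member and close a
    4-cycle. *)
Lemma bounded_chain (U : finType) (C : {set {set U}}) (A B M : {set U}) :
  tree_set_system C -> A \in C -> B \in C -> M \in C ->
  A \subset M -> B \subset M -> (A \subset B) || (B \subset A).
Proof.
move=> hT AC BC MC sAM sBM; apply/negPn/negP; rewrite negb_or => /andP[nAB nBA].
have [med [_ _ _ _ acyclic]] := hT.
have DC : A :&: B \in C by case: med => _ C2 _ _; apply: C2.
have pDA : A :&: B \proper A by rewrite finset.properEneq finset.subsetIl andbT;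
  apply: contra nAB => /eqP/finset.setIidPl.
have pDB : A :&: B \proper B by rewrite finset.properEneq finset.subsetIr andbT;
  apply: contra nBA => /eqP/finset.setIidPr.
have [a [aA aND aDC]] := up_step hT DC AC pDA.
have [b [bB bND bDC]] := up_step hT DC BC pDB.
move: DC aDC bDC aND bND; set D := A :&: B => DC aDC bDC aND bND.
have ab : a != b.
  by apply: contraNneq aND => ab; rewrite finset.inE aA ab bB.
have sDM : D \subset M by apply: fintype.subset_trans sAM; apply: finset.subsetIl.
have abDC : (a |: D) :|: (b |: D) \in C.
  apply: (bounded_setU med aDC bDC MC); rewrite finset.subUset sDM andbT finset.sub1set.
    exact: (fintype.subsetP sAM).
  exact: (fintype.subsetP sBM).
pose v X XC : {X : {set U} | X \in C} := exist _ X XC.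
apply: (acyclic [:: v _ DC; v _ aDC; v _ abDC; v _ bDC]) => //.
have aNbD : a \notin b |: D by rewrite finset.in_setU1 negb_or ab.
have bNaD : b \notin a |: D by rewrite finset.in_setU1 negb_or eq_sym ab.
have abD : (a |: D) :|: (b |: D) = b |: (a |: D).
  by rewrite finset.setUCA -finset.setUA finset.setUid.
rewrite /ucycle /= !andbT; apply/andP; split.
  apply/and4P; split; rewrite /one_inclusion /= ?abD.
  - exact: card_symdiff_setU1.
  - exact: card_symdiff_setU1.
  - by rewrite symdiffC finset.setUCA card_symdiff_setU1.
  - by rewrite symdiffC card_symdiff_setU1.
rewrite !inE -!val_eqE /= !negb_or -!andbA.
have ne c (X Y : {set U}) : c \notin X -> c \in Y -> X != Y.
  by move=> cX cY; apply: contraNneq cX => ->.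
apply/and5P; split; last (apply/andP; split).
- by apply: (ne a) => //; rewrite !finset.inE eqxx.
- by apply: (ne a) => //; rewrite !finset.inE eqxx.
- by apply: (ne b) => //; rewrite !finset.inE eqxx.
- by apply: (ne b) => //; rewrite !finset.inE eqxx orbT.
- by apply: (ne b) => //; rewrite !finset.inE eqxx.
- by rewrite eq_sym; apply: (ne a) => //; rewrite !finset.inE eqxx.
Qed.

(** * Least members containing an element *)

(** For [e] in no member this is all of [U], which need not be a member. *)
Definition least_member (U : finType) (C : {set {set U}}) (e : U) : {set U} :=
  \bigcap_(X in C | e \in X) X.

Lemma least_memberS (U : finType) (C : {set {set U}}) (e : U) (X : {set U}) :
  X \in C -> e \in X -> least_member C e \subset X.
Proof. by move=> XC eX; apply: finset.bigcap_inf; rewrite XC. Qed.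

Lemma mem_least_member (U : finType) (C : {set {set U}}) (e : U) :
  e \in least_member C e.
Proof. by apply/finset.bigcapP => X /andP[]. Qed.

(** A member of minimal cardinality containing [e] lies in every other such [Y]: by (C2) its
    intersection with [Y] is a competitor. *)
Lemma least_member_in (U : finType) (C : {set {set U}}) (e : U) :
  median_set_system C -> e \in finset.cover C -> least_member C e \in C.
Proof.
case=> _ C2 _ _ /finset.bigcupP[X0 X0C eX0].
have P0 : (X0 \in C) && (e \in X0) by rewrite X0C.
case: (@arg_minnP _ X0 (fun X => (X \in C) && (e \in X)) (fun X => #|X|) P0).
move=> X /andP[XC eX] minX; suff -> : least_member C e = X by [].
apply/eqP; rewrite finset.eqEsubset least_memberS //=.
apply/finset.bigcapsP => Y /andP[YC eY]; apply/finset.setIidPl/eqP.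
by rewrite finset.eqEcard finset.subsetIl minX // C2 //= finset.inE eX.
Qed.

(** The least member and [D] both lie below [a |: D], so they are comparable; since [a] is not in
    [D], [D] is the smaller one. *)
Lemma least_member_step (U : finType) (C : {set {set U}}) (a : U) (D : {set U}) :
  tree_set_system C -> D \in C -> a \notin D -> a |: D \in C ->
  least_member C a = a |: D.
Proof.
move=> hT DC aND aDC; have aaD : a \in a |: D by rewrite finset.setU11.
have LC : least_member C a \in C.
  by case: hT => med _; apply: least_member_in => //; apply/finset.bigcupP; exists (a |: D).
have sL := least_memberS aDC aaD.
apply/eqP; rewrite finset.eqEsubset sL finset.subUset finset.sub1set mem_least_member /=.
case/orP: (bounded_chain hT LC DC aDC sL (finset.subsetU1 _ _)) => // /fintype.subsetP/(_ a).
by rewrite mem_least_member (negPf aND) => /(_ isT).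
Qed.

Local Open Scope ring_scope.

(** * The laminar family of intervals *)

Definition ratio (R : realType) (U : finType) : R := #|U|.+1%:R^-1.

(* The digits rank + 1 are at most #|U|, so in base #|U| + 1 the children of a
   member X get disjoint intervals to the right of left_end X + 2 * gap X. *)
Definition left_end (R : realType) (U : finType) (C : {set {set U}}) (X : {set U}) : R :=
  \sum_(f in X) (enum_rank f).+1%:R * ratio R U ^+ #|least_member C f|.

Definition right_end (R : realType) (U : finType) (C : {set {set U}}) (X : {set U}) : R :=
  left_end R C X + ratio R U ^+ #|X|.

(** Half the length of a child's interval: [left_end R C X + gap R X] lies inside the interval of a
    member [X], but before those of its children. *)
Definition gap (R : realType) (U : finType) (X : {set U}) : R :=
  ratio R U ^+ #|X|.+1 / 2.

Lemma ratio_gt0 (R : realType) (U : finType) : 0 < ratio R U.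
Proof. by rewrite invr_gt0 ltr0Sn. Qed.

Lemma ratio_le1 (R : realType) (U : finType) : ratio R U <= 1.
Proof. by rewrite invf_le1 ?ltr0Sn // ler1n. Qed.

Lemma gap_gt0 (R : realType) (U : finType) (X : {set U}) : 0 < gap R X.
Proof. by rewrite divr_gt0 ?exprn_gt0 ?ratio_gt0. Qed.

(** This keeps the child with the largest digit inside its parent's interval. *)
Lemma rank_ratio_le1 (R : realType) (U : finType) (a : U) :
  (enum_rank a).+2%:R * ratio R U <= 1.
Proof. by rewrite ler_pdivrMr ?ltr0Sn // mul1r ler_nat ltnS. Qed.

(** The least member of [a] is [a |: D], so [a] supplies the digit in position [#|D|.+1]. *)
Lemma left_end_step (R : realType) (U : finType) (C : {set {set U}}) (a : U) (D : {set U}) :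
  tree_set_system C -> D \in C -> a \notin D -> a |: D \in C ->
  left_end R C (a |: D) =
  left_end R C D + (enum_rank a).+1%:R * ratio R U ^+ #|D|.+1.
Proof.
move=> hT DC aND aDC; rewrite /left_end finset.big_setU1 //= addrC.
by rewrite (least_member_step hT DC aND aDC) finset.cardsU1 aND.
Qed.

Lemma right_end_step (R : realType) (U : finType) (C : {set {set U}}) (a : U) (D : {set U}) :
  tree_set_system C -> D \in C -> a \notin D -> a |: D \in C ->
  right_end R C (a |: D) =
  left_end R C D + (enum_rank a).+2%:R * ratio R U ^+ #|D|.+1.
Proof.
move=> hT DC aND aDC; rewrite /right_end left_end_step //.
by rewrite finset.cardsU1 aND -addrA [in RHS]mulrSr mulrDl mul1r.
Qed.

(** [up_step] climbs from [X] to [Y] one element at a time, and each step passes to a child's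
    interval. *)
Lemma nested_intervals (R : realType) (U : finType) (C : {set {set U}}) 
    (X Y : {set U}) :
  tree_set_system C -> X \in C -> Y \in C -> X \subset Y ->
  left_end R C X <= left_end R C Y /\ right_end R C Y <= right_end R C X.
Proof.
move=> hT; move: {2}(#|Y :\: X|) (leqnn #|Y :\: X|) => n; elim: n X => [|n IHn] X.
  rewrite leqn0 finset.cards_eq0 finset.setD_eq0 => sYX _ _ sXY.
  by have -> : X = Y by apply/eqP; rewrite finset.eqEsubset sXY.
move=> YXn XC YC sXY; have [sYX|nYX] := boolP (Y \subset X).
  by have -> : X = Y by apply/eqP; rewrite finset.eqEsubset sXY.
have pXY : X \proper Y by rewrite fintype.properE sXY.
have [a [aY aNX aXC]] := up_step hT XC YC pXY.
have saXY : a |: X \subset Y by rewrite finset.subUset finset.sub1set aY.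
have [|] := IHn (a |: X) _ aXC YC saXY.
  rewrite -ltnS; apply: leq_trans YXn; apply: fintype.proper_card.
  apply/fintype.properP; split; first exact/finset.setDS/finset.subsetU1.
  by exists a; rewrite !finset.inE ?aNX ?aY ?eqxx.
rewrite left_end_step // right_end_step // => l r; split.
  apply: le_trans l; rewrite lerDl mulr_ge0 //.
  by rewrite exprn_ge0 // ltW // ratio_gt0.
apply: le_trans r _; rewrite lerD2l exprS mulrA ler_piMl ?rank_ratio_le1 //.
by rewrite exprn_ge0 // ltW // ratio_gt0.
Qed.

(** The ways up to [X] and [Y] part at [X :&: Y] into two children with different ranks, whose
    intervals do not overlap. *)
Lemma disjoint_intervals (R : realType) (U : finType) (C : {set {set U}}) 
    (X Y : {set U}) :
  tree_set_system C -> X \in C -> Y \in C -> ~~ (X \subset Y) -> ~~ (Y \subset X) ->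
  right_end R C X <= left_end R C Y \/ right_end R C Y <= left_end R C X.
Proof.
move=> hT XC YC nXY nYX.
have DC : X :&: Y \in C by case: hT => -[_ C2 _ _] _; apply: C2.
have pDX : X :&: Y \proper X by rewrite finset.properEneq finset.subsetIl andbT;
  apply: contra nXY => /eqP/finset.setIidPl.
have pDY : X :&: Y \proper Y by rewrite finset.properEneq finset.subsetIr andbT;
  apply: contra nYX => /eqP/finset.setIidPr.
have [a [aX aND aDC]] := up_step hT DC XC pDX.
have [b [bY bND bDC]] := up_step hT DC YC pDY.
have saX : a |: (X :&: Y) \subset X.
  by rewrite finset.subUset finset.sub1set aX finset.subsetIl.
have sbY : b |: (X :&: Y) \subset Y.
  by rewrite finset.subUset finset.sub1set bY finset.subsetIr.
have ab : enum_rank a != enum_rank b.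
  apply: contra aND => /eqP/enum_rank_inj ab.
  by rewrite finset.inE aX ab bY.
have [lX rX] := nested_intervals R hT aDC XC saX.
have [lY rY] := nested_intervals R hT bDC YC sbY.
move: lX rX lY rY.
rewrite !left_end_step // !right_end_step // => lX rX lY rY.
have w0 : 0 <= ratio R U ^+ #|X :&: Y|.+1 by rewrite exprn_ge0 // ltW // ratio_gt0.
move: ab; rewrite neq_ltn => /orP[] ab; [left | right].
  apply: le_trans rX (le_trans _ lY).
  by rewrite lerD2l ler_wpM2r // ler_nat.
apply: le_trans rY (le_trans _ lX).
by rewrite lerD2l ler_wpM2r // ler_nat.
Qed.

(** The abscissa chosen for [X] keeps distance [gap R X] from both ends, so the product of the two
    distances is at least its square. *)
Lemma gap_inside (R : realType) (U : finType) (C : {set {set U}}) 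
    (X Y : {set U}) :
  tree_set_system C -> X \in C -> Y \in C -> Y \subset X ->
  left_end R C Y + gap R X <= left_end R C X + gap R X <= right_end R C Y - gap R X.
Proof.
move=> hT XC YC sYX; have [l r] := nested_intervals R hT YC XC sYX.
rewrite lerD2r l /= lerBrDr -addrA -splitr; apply: le_trans r.
by rewrite lerD2l exprS ler_piMl ?ratio_le1 // exprn_ge0 // ltW // ratio_gt0.
Qed.

(** If [X] lies below [Y], then [Y] sits in the interval of a child of [X], beyond the abscissa;
    otherwise the intervals of [X] and [Y] are disjoint. *)
Lemma gap_outside (R : realType) (U : finType) (C : {set {set U}}) 
    (X Y : {set U}) :
  tree_set_system C -> X \in C -> Y \in C -> ~~ (Y \subset X) ->
  left_end R C X + gap R X < left_end R C Y \/
  right_end R C Y < left_end R C X + gap R X.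
Proof.
move=> hT XC YC nYX; have g0 := gap_gt0 R X.
have [sXY|nXY] := boolP (X \subset Y).
  have [|a [aY aNX aXC]] := up_step hT XC YC _; first by rewrite fintype.properE sXY.
  have [|l _] := nested_intervals R hT aXC YC; first by rewrite finset.subUset finset.sub1set aY.
  left; apply: lt_le_trans l; rewrite left_end_step // ltrD2l.
  have -> : ratio R U ^+ #|X|.+1 = gap R X + gap R X by rewrite -splitr.
  rewrite mulrSr mulrDl mul1r addrA ltrDr.
  by rewrite ltr_wpDl // mulr_ge0 // addr_ge0 // ltW.
have [h|h] := disjoint_intervals R hT XC YC nXY nYX; [left | right].
  have /andP[_] := gap_inside R hT XC XC (fintype.subxx _).
  by rewrite lerBrDr => h'; lra.
lra.
Qed.

(** * The region above the parabola and its chords *)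

Definition above_parabola (R : realType) : set 'rV[R]_2 :=
  [set p | p 0 0 ^+ 2 < p 0 1]%classic.

Arguments above_parabola : clear implicits.

Lemma open_above_parabola (R : realType) : open (above_parabola R).
Proof.
have -> : above_parabola R =
    ((fun p : 'rV[R]_2 => p 0 1 - p 0 0 ^+ 2) @^-1` [set x | 0 < x])%classic.
  by apply/seteqP; split=> p; rewrite /above_parabola /= subr_gt0.
apply: open_comp; last exact: open_gt.
move=> p _; have FF : Filter (nbhs p) by exact: nbhs_filter.
have coord j : (p' 0 j @[p' --> p] --> p 0 j)%classic by exact: coord_continuous.
exact: (@cvgB R R^o _ _ FF _ _ _ _ (coord 1) (cvgM (coord 0) (coord 0))).
Qed.

Lemma convex_above_parabola (R : realType) : convex_set (above_parabola R).
Proof.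
move=> p q t; rewrite !inE /above_parabola /= => hp hq.
have t0 : 0 <= t%:num by [].
have t1 : t%:num <= 1 by [].
rewrite !mxE /unstable.onem; move: (t%:num) t0 t1 => s s0 s1.
(* For [s = 0] the strict inequality comes from [q], otherwise from [p]. *)
have [->|s_neq0] := eqVneq s 0; first by rewrite !mul0r !add0r subr0 !mul1r.
have sp : 0 < s by rewrite lt_neqAle eq_sym s_neq0.
have : (s * p 0 0 + (1 - s) * q 0 0) ^+ 2 <= s * p 0 0 ^+ 2 + (1 - s) * q 0 0 ^+ 2.
  rewrite -subr_ge0.
  have -> : s * p 0 0 ^+ 2 + (1 - s) * q 0 0 ^+ 2 - (s * p 0 0 + (1 - s) * q 0 0) ^+ 2
    = s * (1 - s) * (p 0 0 - q 0 0) ^+ 2 by ring.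
  by rewrite mulr_ge0 ?sqr_ge0 // mulr_ge0 // subr_ge0.
move=> /le_lt_trans; apply; apply: ltr_leD; first by rewrite ltr_pM2l.
by rewrite ler_wpM2l ?subr_ge0 // ltW.
Qed.

(* The chord of the parabola y = x^2 through (l, l^2) and (r, r^2) lies on the
   line y = (l + r) x - l r, and y - (l + r) x + l r = (y - x^2) + (x - l) (x - r). *)
Definition chord_normal (R : realType) (l r : R) : 'rV[R]_2 :=
  \row_j (if j == 0 then l + r else -1).

Lemma chord_normal_neq0 (R : realType) (l r : R) : chord_normal l r != 0.
Proof.
apply/eqP => /rowP/(_ 1); rewrite !mxE /= => /eqP.
by rewrite oppr_eq0 oner_eq0.
Qed.

Lemma dot_chord_normal (R : realType) (l r : R) (p : 'rV[R]_2) :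
  dot (chord_normal l r) p = l * r + ((p 0 0 - l) * (r - p 0 0) - (p 0 1 - p 0 0 ^+ 2)).
Proof.
rewrite /dot !big_ord_recl big_ord0 !mxE /=.
rewrite (_ : lift ord0 ord0 = 1); last exact/val_inj.
rewrite (_ : ord0 = 0) //; ring.
Qed.

Lemma pos_side_chord (R : realType) (l r : R) (p : 'rV[R]_2) :
  pos_side (chord_normal l r) (l * r) p <->
  p 0 1 - p 0 0 ^+ 2 < (p 0 0 - l) * (r - p 0 0).
Proof. by rewrite /pos_side /= dot_chord_normal ltrDl subr_gt0. Qed.

Lemma neg_side_chord (R : realType) (l r : R) (p : 'rV[R]_2) :
  neg_side (chord_normal l r) (l * r) p <->
  (p 0 0 - l) * (r - p 0 0) < p 0 1 - p 0 0 ^+ 2.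
Proof. by rewrite /neg_side /= dot_chord_normal gtrDl subr_lt0. Qed.

(* An element lying in no member gets l = r = 0, whose line is tangent to the parabola. *)
Definition element_left (R : realType) (U : finType) (C : {set {set U}}) (e : U) : R :=
  if e \in finset.cover C then left_end R C (least_member C e) else 0.

Definition element_right (R : realType) (U : finType) (C : {set {set U}}) (e : U) : R :=
  if e \in finset.cover C then right_end R C (least_member C e) else 0.

(** * Members as points above the parabola *)

Lemma member_point (R : realType) (U : finType) (C : {set {set U}}) (X : {set U}) :
  tree_set_system C -> X \in C ->
  exists p : 'rV[R]_2, [/\ above_parabola R p,
    forall e, e \in X -> p 0 1 - p 0 0 ^+ 2 <
      (p 0 0 - element_left R C e) * (element_right R C e - p 0 0) &
    forall e, e \notin X ->
      (p 0 0 - element_left R C e) * (element_right R C e - p 0 0) <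
      p 0 1 - p 0 0 ^+ 2].
Proof.
move=> hT XC; have med := hT.1; have g0 := gap_gt0 R X.
set g := gap R X in g0 *; pose x := left_end R C X + g.
(* The height [g ^+ 2 / 2] above the parabola is below the products for [e] in [X], at least
   [g ^+ 2], and above the others, which are at most 0. *)
exists (\row_j (if j == 0 then x else x ^+ 2 + g ^+ 2 / 2)).
rewrite /above_parabola /= !mxE /=.
have g20 : 0 < g ^+ 2 / 2 by rewrite divr_gt0 // exprn_gt0.
have -> : x ^+ 2 + g ^+ 2 / 2 - x ^+ 2 = g ^+ 2 / 2 by ring.
split; first by rewrite ltrDl.
  move=> e eX; have ecov : e \in finset.cover C by apply/finset.bigcupP; exists X.
  have LC := least_member_in med ecov.
  rewrite /element_left /element_right ecov.
  have /andP[] := gap_inside R hT XC LC (least_memberS XC eX).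
  rewrite -/g -/x; move: (left_end _ _ _) (right_end _ _ _) => l r lx xr.
  apply: (@lt_le_trans _ _ (g * g)); first by rewrite expr2; nra.
  by apply: ler_pM; lra.
move=> e eNX; rewrite /element_left /element_right.
case: ifPn => ecov; last first.
  by apply: le_lt_trans g20; rewrite subr0 sub0r mulrN -expr2 oppr_le0 sqr_ge0.
have LC := least_member_in med ecov.
have nLX : ~~ (least_member C e \subset X).
  by apply: contra eNX => /fintype.subsetP; apply; apply: mem_least_member.
have lr : left_end R C (least_member C e) < right_end R C (least_member C e).
  by rewrite ltrDl exprn_gt0 // ratio_gt0.
have := gap_outside R hT XC LC nLX; rewrite -/g -/x.
move: (left_end _ _ _) (right_end _ _ _) lr => l r lr xlr.
by apply: lt_trans g20; case: xlr => ?; nra.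
Qed.

(** The intervals of the elements of [X] share the abscissa of [p], so their least members form a
    chain, and [X] is contained in the largest. Conversely, an element of that largest one has a
    wider interval, hence a larger product, and must be in [X]. *)
Lemma point_member (R : realType) (U : finType) (C : {set {set U}}) (X : {set U})
    (p : 'rV[R]_2) :
  tree_set_system C -> above_parabola R p ->
  (forall e, e \in X -> p 0 1 - p 0 0 ^+ 2 <
      (p 0 0 - element_left R C e) * (element_right R C e - p 0 0)) ->
  (forall e, e \notin X ->
      (p 0 0 - element_left R C e) * (element_right R C e - p 0 0) <
      p 0 1 - p 0 0 ^+ 2) ->
  X \in C.
Proof.
move=> hT; have med := hT.1; rewrite /above_parabola /= -subr_gt0.
move: (p 0 0) (p 0 1 - p 0 0 ^+ 2) => x s s0 posX negX.
(* Outside the cover the product is [- x ^+ 2], which cannot exceed [s]. *)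
have Xcov e : e \in X -> e \in finset.cover C.
  move=> /posX; rewrite /element_left /element_right.
  by case: ifP => // _; have := sqr_ge0 x; rewrite expr2; nra.
have inX e : e \in X ->
    left_end R C (least_member C e) < x < right_end R C (least_member C e).
  move=> eX; have := posX e eX; rewrite /element_left /element_right Xcov //.
  have lr : left_end R C (least_member C e) < right_end R C (least_member C e).
    by rewrite ltrDl exprn_gt0 // ratio_gt0.
  move: (left_end _ _ _) (right_end _ _ _) lr => l r lr h.
  by apply/andP; split; rewrite ltNge; apply/negP => h'; nra.
have [X0|[e0 e0X]] := finset.set_0Vmem X; first by rewrite X0; case: med.
have [m mX maxm] := @arg_maxnP _ e0 (mem X) (fun e => #|least_member C e|) e0X.
have LmC := least_member_in med (Xcov m mX).
suff -> : X = least_member C m by [].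
apply/finset.setP => e; apply/idP/idP => [eX|eL].
  have LeC := least_member_in med (Xcov e eX).
  apply: (fintype.subsetP _ _ (mem_least_member C e)).
  have [//|nem] := boolP (least_member C e \subset least_member C m).
  have [sme|nme] := boolP (least_member C m \subset least_member C e).
    by move: nem; rewrite finset.subEproper eq_sym finset.eqEcard sme; have /= -> := maxm e eX.
  have /andP[? ?] := inX e eX; have /andP[? ?] := inX m mX.
  by have [?|?] := disjoint_intervals R hT LeC LmC nem nme; lra.
apply/negPn/negP => eNX.
have ecov : e \in finset.cover C by apply/finset.bigcupP; exists (least_member C m).
have LeC := least_member_in med ecov.
have [l r] := nested_intervals R hT LeC LmC (least_memberS LmC eL).
have := negX e eNX; have := posX m mX; have /andP[lx xr] := inX m mX.
rewrite /element_left /element_right ecov Xcov //.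
move: (left_end R C (least_member C m)) (right_end R C (least_member C m)) l r lx xr.
move: (left_end _ _ _) (right_end _ _ _) => l' r' l r ll rr lx xr h1 h2.
have : (x - l) * (r - x) <= (x - l') * (r' - x) by apply: ler_pM; lra.
lra.
Qed.

Lemma tree_realizable2 (R : realType) (U : finType) (C : {set {set U}}) :
  tree_set_system C -> realizable R C 2.
Proof.
move=> hT.
exists (fun e => chord_normal (element_left R C e) (element_right R C e)).
exists (fun e => element_left R C e * element_right R C e), (above_parabola R).
split=> [e|||X].
- exact: chord_normal_neq0.
- exact/open_subspaceW/open_above_parabola.
- exact: convex_above_parabola.
- split=> [XC|[p [Kp pos neg]]].
    have [p [Kp pos neg]] := member_point R hT XC.
    by exists p; split=> // e /[dup] eX; [move/pos => /pos_side_chord | move/neg => /neg_side_chord].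
  apply: (point_member hT Kp) => e.
    by move/pos => /pos_side_chord.
  by move/neg => /neg_side_chord.
Qed.

Theorem proposition41 (R : realType) (U : finType) (C : {set {set U}})
    (hT : tree_set_system C) :
  realizable R C 2 /\ exists2 d : nat, euclidean_dim R C d & (d <= 2)%N.
Proof.
have r2 := tree_realizable2 R hT; split=> //.
have ex : exists m, `[< realizable R C m >] by exists 2%N; apply/asboolP.
case: (ex_minnP ex) => d /asboolP rd mind; exists d; last exact/mind/asboolP.
by split=> // m rm; apply/mind/asboolP.
Qed.
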